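(* Let $n=1$, $\beta>1/2$, $\sigma\geq 1$, and let $\sigma_\beta=\exp\left(\frac{2\beta}{2\beta-1}\right)$. Then $(L,\Gamma,\mu_{\beta,\sigma})$ satisfies the curvature-dimension criterion $CD(2\beta-1,\infty)$ if and only if $\sigma\geq\sigma_\beta$.
   Context: For $\beta>1/2$ and $\sigma\ge 1$, $\mu_{\beta,\sigma}$ is the probability measure on $\mathbb{R}$ with density proportional to $(\sigma+x^2)^{-\beta}$. Let $\omega_\sigma(x)=\sigma+x^2$. The operator $L$ is defined on the set $\mathcal{C}_c^\infty(\mathbb{R})$ of smooth compactly supported functions by $$Lf(x)=\omega_\sigma(x)\log(\omega_\sigma(x))f''(x)+2\left(1-(\beta-1)\log(\omega_\sigma(x))\right)x f'(x);$$ it is symmetric with respect to $\mu_{\beta,\sigma}$. The carré-du-champ operator is $\Gamma(f,g)=\frac12\left(L(fg)-fLg-gLf\right)$, $\Gamma(f)=\Gamma(f,f)$, i.e. $2\Gamma(f)=L(f^2)-2fLf$, and the iterated carré-du-champ is $2\Gamma_2(f)=L\Gamma(f)-2\Gamma(f,Lf)$. For $\rho\in\mathbb{R}$, $(L,\Gamma,\nu)$ satisfies $CD(\rho,\infty)$ if $\Gamma_2(f)\geq\rho\,\Gamma(f)$ pointwise for all $f\in\mathcal{C}_c^\infty(\mathbb{R})$. *)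

(* Defs.v *)
From HB Require Import structures.
From mathcomp Require Import all_boot all_order all_algebra.
From mathcomp Require Import all_classical all_reals all_analysis.
From mathcomp Require Import measurable_realfun.

Set Implicit Arguments.
Unset Strict Implicit.
Unset Printing Implicit Defensive.

Import Order.TTheory GRing.Theory Num.Theory.
Import numFieldNormedType.Exports.

Local Open Scope classical_set_scope.
Local Open Scope ring_scope.

Definition smooth (R : realType) (f : R -> R) : Prop :=
  forall (n : nat) (x : R), derivable (derive1n n f) x 1.

Definition compactly_supported (R : realType) (f : R -> R) : Prop :=
  compact (closure [set x | f x != 0]).

Definition Cc_infty (R : realType) : set (R -> R) :=
  [set f | smooth f /\ compactly_supported f].

Definition omega (R : realType) (sigma x : R) : R := sigma + x ^+ 2.

Definition weight (R : realType) (beta sigma x : R) : R :=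
  omega sigma x `^ (- beta).

Definition weighted_measure (R : realType) (beta sigma : R)
    (A : set (measurableTypeR R)) : \bar R :=
  (\int[lebesgue_measure]_(x in A) (weight beta sigma x)%:E)%E.

Section weighted_measure_is_measure.
Variables (R : realType) (beta sigma : R).

Let measurable_weight :
  measurable_fun [set: measurableTypeR R] (weight beta sigma).
Proof.
apply: (measurableT_comp (measurable_powR (- beta))).
by apply: measurable_funD => //; exact: measurable_funX.
Qed.

Let weighted_measure0 : weighted_measure beta sigma set0 = 0%E.
Proof. by rewrite /weighted_measure integral_set0. Qed.

Let weighted_measure_ge0 A : (0 <= weighted_measure beta sigma A)%E.
Proof. by apply: integral_ge0 => x _; rewrite lee_fin powR_ge0. Qed.

Let weighted_measure_sigma_additive :
  semi_sigma_additive (weighted_measure beta sigma).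
Proof.
move=> /= F mF tF mUF; rewrite /weighted_measure ge0_integral_bigcup//=; last 2 first.
- by apply/measurable_EFinP; exact: measurable_funTS.
- by move=> x _; rewrite lee_fin powR_ge0.
apply: is_cvg_ereal_nneg_natsum_cond => n _ _.
by apply: integral_ge0 => x _; rewrite lee_fin powR_ge0.
Qed.

HB.instance Definition _ := isMeasure.Build _ _ _
  (weighted_measure beta sigma) weighted_measure0 weighted_measure_ge0
  weighted_measure_sigma_additive.

End weighted_measure_is_measure.

(* The Dirac mass is the fallback of [mnormalize] for a measure of total mass
   0 or +oo; it plays no role when 1/2 < beta and 1 <= sigma, where the weight
   is positive and integrable. *)
Definition mu (R : realType) (beta sigma : R) :
    probability (measurableTypeR R) R :=
  mnormalize (weighted_measure beta sigma) (dirac (0 : measurableTypeR R)).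

(* Operators act on all functions R -> R; with the total derivative of the
   library they agree with the mathematical ones on [Cc_infty], which is
   stable under [L beta sigma] when 1 <= sigma. *)
Definition L (R : realType) (beta sigma : R) (f : R -> R) (x : R) : R :=
  omega sigma x * ln (omega sigma x) * derive1n 2 f x
  + 2 * (1 - (beta - 1) * ln (omega sigma x)) * x * derive1 f x.

Section carre_du_champ.
Variables (R : realType) (A : (R -> R) -> R -> R).

Definition Gamma (f g : R -> R) (x : R) : R :=
  2^-1 * (A (f \* g) x - f x * A g x - g x * A f x).

End carre_du_champ.

Definition Gamma2 (R : realType) (A : (R -> R) -> R -> R)
    (G : (R -> R) -> (R -> R) -> R -> R) (f : R -> R) (x : R) : R :=
  2^-1 * (A (G f f) x - 2 * G f (A f) x).

(* The criterion is a pointwise inequality on the core [Cc_infty]: the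
   reference measure [nu] belongs to the triple but does not enter it. *)
Definition CD (R : realType) (A : (R -> R) -> R -> R)
    (G : (R -> R) -> (R -> R) -> R -> R)
    (nu : probability (measurableTypeR R) R) (rho : R) : Prop :=
  forall f : R -> R, Cc_infty f -> forall x : R,
    rho * G f f x <= Gamma2 A G f x.

Definition sigma_crit (R : realType) (beta : R) : R :=
  expR (2 * beta / (2 * beta - 1)).

(* Main.v *)
Require Import Defs.
From mathcomp Require Import all_boot all_order all_algebra.
From mathcomp Require Import all_classical all_reals all_analysis.
From mathcomp Require Import ring lra.
Import Order.TTheory GRing.Theory Num.Theory.
Import numFieldNormedType.Exports.
Local Open Scope ring_scope.
Set Implicit Arguments.
Unset Strict Implicit.
Unset Printing Implicit Defensive.

(** Write [L f = a f'' + b f'] with [a = w ln w], [w = omega sigma].  For every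
    diffusion of this shape the product rule gives [Gamma f f = a f'^2], and,
    after completing the square in [f''],
    [Gamma2 f = (a f'' + a' f' / 2)^2 + curvature * f'^2], where [curvature]
    depends on [a] and [b] only (lemma [Gamma2_diffusion]).  So [CD rho] holds
    as soon as [rho a <= curvature] everywhere.  Conversely, where [a] does not
    vanish, a test function with [f' = 1] and [f'' = - a' / (2 a)] cancels the
    square and [CD rho] forces [rho a <= curvature] there.  Such test functions
    exist because a smooth bump multiplied by a polynomial of degree two can be
    given arbitrary first and second derivatives at its centre (lemma
    [Cc_infty_jet]); the bump is made from [exp (- 1 / x)].

    For the operator [L] and [rho = 2 beta - 1], substituting
    [x^2 = w - sigma] gives
    [curvature - rho a = w - sigma (1 + 2 beta l - rho l^2)] with [l = ln w]
    (lemma [curvature_L]).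
    If [sigma >= sigma_crit], that is [rho ln sigma >= 2 beta], then
    [l >= ln sigma] makes [2 beta l - rho l^2] nonpositive and the difference
    is at least [w - sigma >= 0].
    If [1 < sigma < sigma_crit], then at [x = 0], where [w = sigma], the
    difference is [- sigma ln sigma (2 beta - rho ln sigma) < 0].
    If [sigma = 1], then [a] vanishes at [0] and a nearby point is needed: as
    [w = exp l = 1 + l + o(l)] is smaller than [1 + 2 beta l + o(l)], the
    difference is negative for small positive [l]. *)

(** * Derivatives as functions *)

(** A relation between functions, rather than an equation for [derive1]: it
    lets derivatives of compound expressions be built up together with their
    existence. *)
Definition has_derivative (R : realType) (f f' : R -> R) : Prop :=
  forall x : R, is_derive x 1 f (f' x).

Section HasDerivative.
Variable R : realType.
Implicit Types f g h : R -> R.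

Lemma has_derivative_ext f f' h h' : f =1 h -> f' =1 h' ->
  has_derivative f f' -> has_derivative h h'.
Proof. by move=> /funext <- /funext <-. Qed.

Lemma has_derivativeE f f' : has_derivative f f' -> derive1 f = f'.
Proof. by move=> df; apply/funext => x; rewrite derive1E (@derive_val _ _ _ _ _ _ _ (df x)). Qed.

Lemma has_derivative2E f f' f'' : has_derivative f f' -> has_derivative f' f'' ->
  derive1n 2 f = f''.
Proof.
by move=> /has_derivativeE f1 /has_derivativeE f2; rewrite /derive1n /= f1 f2.
Qed.

Lemma smooth_has_derivative f n : smooth f ->
  has_derivative (derive1n n f) (derive1n n.+1 f).
Proof.
move=> sf x; rewrite derive1nS derive1E; exact/derivableP/sf.
Qed.

Lemma has_derivative_cst (c : R) : has_derivative (fun=> c) (fun=> 0).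
Proof. by move=> x; exact: is_derive_cst. Qed.

Lemma has_derivative_id : has_derivative (fun x : R => x) (fun=> 1).
Proof. by move=> x; exact: is_derive_id. Qed.

Lemma has_derivativeD f f' g g' : has_derivative f f' -> has_derivative g g' ->
  has_derivative (fun x => f x + g x) (fun x => f' x + g' x).
Proof. by move=> df dg x; exact: is_deriveD. Qed.

Lemma has_derivativeM f f' g g' : has_derivative f f' -> has_derivative g g' ->
  has_derivative (fun x => f x * g x) (fun x => f' x * g x + f x * g' x).
Proof.
move=> df dg x; apply: is_derive_eq (is_deriveM (df x) (dg x)) _.
by rewrite addrC mulrC.
Qed.

Lemma has_derivativeV f f' : (forall x, f x != 0) -> has_derivative f f' ->
  has_derivative (fun x => (f x)^-1) (fun x => - f' x * (f x)^-1 ^+ 2).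
Proof.
move=> f0 df x; apply: is_derive_eq (is_deriveV (f0 x) (df x)) _.
by rewrite exprVn mulNr mulrC -mulNr.
Qed.

Lemma has_derivative_ln f f' : (forall x, 0 < f x) -> has_derivative f f' ->
  has_derivative (fun x => ln (f x)) (fun x => f' x / f x).
Proof.
move=> f0 df x; rewrite mulrC.
exact: (is_derive1_comp (is_derive1_ln (f0 x)) (df x)).
Qed.

Lemma has_derivative_comp f f' g g' : has_derivative f f' ->
  has_derivative g g' -> has_derivative (f \o g) (fun x => f' (g x) * g' x).
Proof. by move=> df dg x; exact: (is_derive1_comp (df (g x)) (dg x)). Qed.

End HasDerivative.

(** * Closure properties of smooth functions *)

Section Smooth.
Variable R : realType.
Implicit Types f g : R -> R.

(** Smoothness is graded by the number of derivatives because the product and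
    chain rules express the derivative by products that involve the functions
    themselves: with a bound on the order, both closure properties follow by
    induction. *)
Fixpoint times_derivable (n : nat) f : Prop :=
  if n is n'.+1 then exists2 f', has_derivative f f' & times_derivable n' f'
  else True.

Lemma times_derivableP f : smooth f <-> forall n, times_derivable n f.
Proof.
split=> [sf n|sf n x].
  suff: forall k, times_derivable n (derive1n k f) by move=> /(_ 0%N).
  elim: n => [//|n IH] k; exists (derive1n k.+1 f) => //.
  exact: smooth_has_derivative.
suff: exists2 g, has_derivative (derive1n n f) g & True.
  by move=> [g dg _]; exact: (@ex_derive _ _ _ _ _ _ _ (dg x)).
suff H k : times_derivable k (derive1n n f).
  by have [g dg _] := H 1%N; exists g.
elim: n k => [|n IH] k; first exact: sf.
by have [g dg sg] := IH k.+1; rewrite derive1nS (has_derivativeE dg).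
Qed.

Lemma times_derivableW n f : times_derivable n.+1 f -> times_derivable n f.
Proof. by elim: n f => [//|n IH] f [g dg sg]; exists g => //; exact: IH. Qed.

Lemma times_derivable_cst n (c : R) : times_derivable n (fun=> c).
Proof.
elim: n c => [//|n IH] c; exists (fun=> 0) => //; exact: has_derivative_cst.
Qed.

Lemma times_derivable_id n : times_derivable n (fun x : R => x).
Proof.
case: n => [//|n]; exists (fun=> 1); first exact: has_derivative_id.
exact: times_derivable_cst.
Qed.

Lemma times_derivableD n f g : times_derivable n f -> times_derivable n g ->
  times_derivable n (fun x => f x + g x).
Proof.
elim: n f g => [//|n IH] f g [f' df sf] [g' dg sg].
by exists (fun x => f' x + g' x); [exact: has_derivativeD | exact: IH].
Qed.

Lemma times_derivableM n f g : times_derivable n f -> times_derivable n g ->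
  times_derivable n (fun x => f x * g x).
Proof.
elim: n f g => [//|n IH] f g nf ng.
have [f' df sf] := nf; have [g' dg sg] := ng.
exists (fun x => f' x * g x + f x * g' x); first exact: has_derivativeM.
by apply: times_derivableD; apply: IH => //; exact: times_derivableW.
Qed.

Lemma times_derivable_comp n f g : times_derivable n f ->
  times_derivable n g -> times_derivable n (f \o g).
Proof.
elim: n f g => [//|n IH] f g [f' df sf] ng.
have [g' dg sg] := ng.
exists (fun x => (f' \o g) x * g' x); first exact: has_derivative_comp.
by apply: times_derivableM => //; apply: IH => //; exact: times_derivableW.
Qed.

Lemma smooth_cst (c : R) : smooth (fun=> c).
Proof. by apply/times_derivableP => n; exact: times_derivable_cst. Qed.

Lemma smooth_id : smooth (fun x : R => x).
Proof. by apply/times_derivableP => n; exact: times_derivable_id. Qed.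

Lemma smoothD f g : smooth f -> smooth g -> smooth (fun x => f x + g x).
Proof.
move=> /times_derivableP sf /times_derivableP sg.
by apply/times_derivableP => n; exact: times_derivableD.
Qed.

Lemma smoothM f g : smooth f -> smooth g -> smooth (fun x => f x * g x).
Proof.
move=> /times_derivableP sf /times_derivableP sg.
by apply/times_derivableP => n; exact: times_derivableM.
Qed.

Lemma smooth_comp f g : smooth f -> smooth g -> smooth (f \o g).
Proof.
move=> /times_derivableP sf /times_derivableP sg.
by apply/times_derivableP => n; exact: times_derivable_comp.
Qed.

End Smooth.

(** * The flat function exp(-1/x) *)

Section FlatExponential.
Variable R : realType.
Implicit Types (x u C : R) (P : {poly R}).

(** The polynomial factor in [1 / x] makes the family closed under
    differentiation, which reduces smoothness to a single derivative. *)
Definition flat_exp P x : R := if 0 < x then P.[x^-1] * expR (- x^-1) else 0.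

Lemma expr_expRN_le n u : 0 <= u -> u ^+ n * expR (- u) <= n`!%:R.
Proof.
move=> u0; rewrite expRN ler_pdivrMr ?expR_gt0//.
case: n => [|n]; first by rewrite expr0 fact0 mul1r -expR0 ler_expR.
have F0 : 0 < (n.+1)`!%:R :> R by rewrite ltr0n fact_gt0.
rewrite mulrC -ler_pdivrMr//; apply: le_trans (expR_ge1Dxn n u0).
by rewrite lerDr.
Qed.

(** The power [u ^+ n] is there for the induction on [P], where multiplication
    of [P] by the variable raises [n] by one. *)
Lemma poly_expRN_bounded P n :
  exists C, forall u, 0 <= u -> `|u ^+ n * P.[u] * expR (- u)| <= C.
Proof.
elim/poly_ind: P n => [|P c IH] n.
  by exists 0 => u u0; rewrite horner0 mulr0 mul0r normr0.
have [C HC] := IH n.+1; exists (C + `|c| * n`!%:R) => u u0.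
rewrite hornerMXaddC.
have -> : u ^+ n * (P.[u] * u + c) * expR (- u) =
    u ^+ n.+1 * P.[u] * expR (- u) + c * (u ^+ n * expR (- u)).
  by rewrite exprS; ring.
apply: le_trans (ler_normD _ _) _; apply: lerD; first exact: HC.
rewrite normrM ler_wpM2l// ger0_norm ?expr_expRN_le//.
by rewrite mulr_ge0 ?exprn_ge0 ?expR_ge0.
Qed.

(** Boundedness of [u^2 P(u) exp(-u)] at [u = 1 / x]; the quadratic decay is
    what makes the derivative at the origin vanish. *)
Lemma flat_exp_le_sqr P : exists C, forall x, `|flat_exp P x| <= C * x ^+ 2.
Proof.
have [C HC] := poly_expRN_bounded P 2; exists C => x.
have C0 : 0 <= C by apply: le_trans (HC 0 (lexx _)).
rewrite /flat_exp; case: ifPn => [x0|_]; last first.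
  by rewrite normr0 mulr_ge0 ?sqr_ge0.
have ix0 : 0 <= x^-1 by rewrite invr_ge0 ltW.
rewrite -ler_pdivrMr ?exprn_gt0//; apply: le_trans (HC _ ix0).
rewrite le_eqVlt; apply/orP; left; apply/eqP.
rewrite -mulrA [RHS]normrM [`|x^-1 ^+ 2|]ger0_norm ?exprn_ge0//.
by rewrite exprVn mulrC.
Qed.

(** The difference quotient at [0] is bounded by [C |z|], hence tends to [0]. *)
Lemma is_derive0_le_sqr (f : R -> R) C :
  (forall x, `|f x| <= C * x ^+ 2) -> is_derive (0 : R) 1 f 0.
Proof.
move=> fC; have f0 : f 0 = 0.
  by apply/normr0_eq0/le_anti; rewrite normr_ge0 (le_trans (fC 0))// expr0n mulr0.
apply/is_derive1_caratheodory; exists (fun z => f z / z); split.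
- move=> z; rewrite f0 !subr0; have [->|z0] := eqVneq z 0.
    by rewrite mulr0 f0.
  by rewrite divfK.
- have lim0 : (C * `|z| @[z --> (0 : R)] --> (0 : R))%classic.
    rewrite -[X in (_ --> X)%classic](mulr0 C); apply: cvgM; first exact: cvg_cst.
    by rewrite -[X in (_ --> X)%classic](normr0 R); exact: norm_continuous.
  suff : (f z / z @[z --> (0 : R)] --> (0 : R))%classic.
    by rewrite /prop_for /continuous_at invr0 mulr0.
  apply/cvgr0Pnorm_le => e e0.
  move/cvgr0Pnorm_le: lim0 => /(_ e e0); apply: filterS => z; apply: le_trans.
  have [->|z0] := eqVneq z 0; first by rewrite invr0 mulr0 normr0 mulr0 normr0.
  rewrite normrM normfV ler_pdivrMr ?normr_gt0//.
  apply: le_trans (fC z) _.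
  rewrite -(real_normK (num_real z)) expr2 mulrA ler_wpM2r//.
  exact: ler_norm.
- by rewrite /= invr0 mulr0.
Qed.

(** For positive [x], with [u = 1 / x] and [u' = - u^2], the derivative of
    [P(u) exp(-u)] is [u^2 (P - P')(u) exp(-u)]; at the origin the quadratic
    decay gives the derivative [0]. *)
Lemma flat_exp_has_derivative P :
  has_derivative (flat_exp P) (flat_exp ('X^2 * (P - P^`()))).
Proof.
move=> x; have [x0|x0|->] := ltgtP x 0.
- rewrite [X in is_derive _ _ _ X]/flat_exp ltNge ltW//=.
  apply: near_eq_is_derive (is_derive_cst (0 : R) x 1).
  near=> y; rewrite /flat_exp ifF//; apply/negbTE; rewrite -leNgt ltW//.
  by near: y; exact: lt_nbhsl.
- rewrite [X in is_derive _ _ _ X]/flat_exp x0.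
  have dV : is_derive x 1 (fun y : R => y^-1) (- x ^- 2).
    apply: is_derive_eq (is_deriveV (lt0r_neq0 x0) (is_derive_id x 1)) _.
    by rewrite /GRing.scale /= mulr1.
  have dP := is_derive1_comp (is_derive_poly P x^-1) dV.
  have dE := @is_derive1_comp R expR (fun y => - y^-1) x _ _
    (is_derive_expR _) (is_deriveN dV).
  have dM : is_derive x 1 (fun y => P.[y^-1] * expR (- y^-1))
      (('X^2 * (P - P^`())).[x^-1] * expR (- x^-1)).
    apply: is_derive_eq (is_deriveM dP dE) _.
    rewrite /GRing.scale /= hornerM hornerXn hornerD hornerN exprVn; ring.
  apply: near_eq_is_derive dM; near=> y; rewrite /flat_exp ifT//.
  by near: y; exact: lt_nbhsr.
- have [C HC] := flat_exp_le_sqr P.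
  by rewrite [X in is_derive _ _ _ X]/flat_exp ltxx; exact: is_derive0_le_sqr HC.
Unshelve. all: by end_near. Qed.

Lemma smooth_flat_exp P : smooth (flat_exp P).
Proof.
apply/times_derivableP => n; elim: n P => [//|n IH] P.
exists (flat_exp ('X^2 * (P - P^`()))) => //; exact: flat_exp_has_derivative.
Qed.

End FlatExponential.

(** * Test functions with a prescribed jet *)

Section TestFunctions.
Variable R : realType.
Implicit Types (f g : R -> R) (x : R).

Definition bump (a x : R) : R := flat_exp 1 (1 - (x - a) ^+ 2).

Lemma smooth_bump a : smooth (bump a).
Proof.
have sB : smooth (fun x : R => x - a).
  by apply: smoothD; [exact: smooth_id | exact: smooth_cst].
suff sg : smooth (fun x : R => 1 - (x - a) ^+ 2).
  exact: (smooth_comp (@smooth_flat_exp R 1) sg).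
apply: smoothD; first exact: smooth_cst.
rewrite (_ : (fun _ => _) = fun x => -1 * ((x - a) * (x - a))); last first.
  by apply/funext => x; rewrite mulN1r expr2.
by apply: smoothM; [exact: smooth_cst | exact: smoothM].
Qed.

Lemma bump_gt0 a : 0 < bump a a.
Proof.
rewrite /bump subrr expr0n subr0 /flat_exp ltr01 hornerC mul1r; exact: expR_gt0.
Qed.

Lemma bump_neq0 a x : bump a x != 0 -> (x \in `[a - 1, a + 1])%R.
Proof.
rewrite /bump /flat_exp; case: ifPn => [|_]; last by rewrite eqxx.
move=> H _; rewrite in_itv /=; nra.
Qed.

Lemma Cc_infty_mul_bump a f : smooth f -> Cc_infty (fun x => bump a x * f x).
Proof.
move=> sf; split; first by apply: smoothM => //; exact: smooth_bump.
apply: (@subclosed_compact _ _ (`[a - 1, a + 1])%classic).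
- exact: closed_closure.
- exact: segment_compact.
- rewrite [X in (_ `<=` X)%classic](closure_id _).1; last exact: interval_closed.
  apply: closureS => x /=; rewrite mulf_eq0 negb_or => /andP[/bump_neq0 ? _] //.
Qed.

(** The product of a bump [h] with the polynomial [c (x - a) + d (x - a)^2] has
    derivatives [h(a) c] and [2 h'(a) c + 2 h(a) d] at [a].  Since [h(a) != 0],
    this triangular system can be solved for any prescribed values. *)
Lemma Cc_infty_jet (a p q : R) : exists f : R -> R,
  [/\ Cc_infty f, derive1n 1 f a = p & derive1n 2 f a = q].
Proof.
have h0 := bump_gt0 a; have sh := @smooth_bump a.
set h := bump a in h0 sh.
set c := p / h a; set d := (q - 2 * derive1n 1 h a * c) / (2 * h a).
pose P x := (x - a) * (c + d * (x - a)).
exists (fun x => h x * P x).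
have d1 := smooth_has_derivative 0 sh; have d2 := smooth_has_derivative 1 sh.
have dB : has_derivative (fun x : R => x - a) (fun=> 1 + 0).
  apply: has_derivativeD; [exact: has_derivative_id | exact: has_derivative_cst].
have dP : has_derivative P (fun x => c + 2 * d * (x - a)).
  apply: has_derivative_ext (has_derivativeM dB (has_derivativeD
    (has_derivative_cst c) (has_derivativeM (has_derivative_cst d) dB))) => //.
  by move=> x /=; ring.
have dP' : has_derivative (fun x => c + 2 * d * (x - a)) (fun=> 2 * d).
  apply: has_derivative_ext (has_derivativeD (has_derivative_cst c)
    (has_derivativeM (has_derivative_cst (2 * d)) dB)) => //.
  by move=> x /=; ring.
have dF := has_derivativeM d1 dP.
have dF' := has_derivativeD (has_derivativeM d2 dP) (has_derivativeM d1 dP').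
have ha : h a != 0 by rewrite gt_eqF.
split.
- apply: Cc_infty_mul_bump; apply: smoothM.
    by apply: smoothD; [exact: smooth_id | exact: smooth_cst].
  apply: smoothD; first exact: smooth_cst.
  apply: smoothM; first exact: smooth_cst.
  by apply: smoothD; [exact: smooth_id | exact: smooth_cst].
- rewrite derive1n1 (has_derivativeE dF) /= /P /c; by field.
- by rewrite (has_derivative2E dF dF') /P /d /= !subrr; field.
Qed.

End TestFunctions.

(** * Curvature of a one-dimensional diffusion *)

Section Diffusion.
Variable R : realType.
Variables a a1 a2 b b1 b2 : R -> R.
Hypotheses (da : has_derivative a a1) (da1 : has_derivative a1 a2).
Hypotheses (db : has_derivative b b1) (db1 : has_derivative b1 b2).
Implicit Types f g : R -> R.

Definition diffusion f (x : R) : R := a x * derive1n 2 f x + b x * derive1 f x.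

(** The coefficient of [f'^2] left in [Gamma2] once the square in [f''] has been
    completed; where [a] does not vanish it is the minimum of [Gamma2] over all
    values of [f''], for [f' = 1]. *)
Definition curvature (x : R) : R :=
  2^-1 * (a x * a2 x + b x * a1 x) - a x * b1 x - (2^-1 * a1 x) ^+ 2.

Lemma Gamma_diffusion f f1 f2 g g1 g2 :
  has_derivative f f1 -> has_derivative f1 f2 ->
  has_derivative g g1 -> has_derivative g1 g2 ->
  Gamma diffusion f g = fun x => a x * (f1 x * g1 x).
Proof.
move=> df df1 dg dg1; apply/funext => x.
have dfg := has_derivativeM df dg.
have dfg1 := has_derivativeD (has_derivativeM df1 dg) (has_derivativeM df dg1).
rewrite /Gamma /diffusion (has_derivative2E df df1) (has_derivative2E dg dg1).
rewrite (has_derivativeE df) (has_derivativeE dg).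
rewrite (has_derivativeE (f := f \* g) dfg) (has_derivative2E (f := f \* g) dfg dfg1).
by field.
Qed.

(** The terms in [f'''] cancel between [L (Gamma f)] and [2 Gamma (f, L f)], so
    what remains is a quadratic form in [f'] and [f'']. *)
Lemma Gamma2_diffusion f x : smooth f ->
  Gamma2 diffusion (Gamma diffusion) f x =
  (a x * derive1n 2 f x + 2^-1 * a1 x * derive1n 1 f x) ^+ 2
  + curvature x * derive1n 1 f x ^+ 2.
Proof.
move=> sf; have d0 := smooth_has_derivative 0 sf.
have d1 := smooth_has_derivative 1 sf; have d2 := smooth_has_derivative 2 sf.
have d3 := smooth_has_derivative 3 sf.
have dL := has_derivativeD (has_derivativeM da d2) (has_derivativeM db d1).
have dL1 := has_derivativeD
  (has_derivativeD (has_derivativeM da1 d2) (has_derivativeM da d3))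
  (has_derivativeD (has_derivativeM db1 d1) (has_derivativeM db d2)).
have dff := has_derivativeM d1 d1.
have dff1 := has_derivativeD (has_derivativeM d2 d1) (has_derivativeM d1 d2).
have dG := has_derivativeM da dff.
have dG1 := has_derivativeD (has_derivativeM da1 dff) (has_derivativeM da dff1).
rewrite /Gamma2 (Gamma_diffusion d0 d1 d0 d1) (Gamma_diffusion d0 d1 dL dL1).
rewrite {1}/diffusion (has_derivativeE dG) (has_derivative2E dG dG1) /curvature.
move: (derive1n 1 f x) (derive1n 2 f x) (derive1n 3 f x) => f1 f2 f3.
move: (a x) (a1 x) (a2 x) (b x) (b1 x) => c c1 c2 e e1.
by field.
Qed.

Lemma CD_diffusion nu rho : (forall x, rho * a x <= curvature x) ->
  CD diffusion (Gamma diffusion) nu rho.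
Proof.
move=> le_rho f [sf _] x; have d0 := smooth_has_derivative 0 sf.
have d1 := smooth_has_derivative 1 sf.
rewrite (Gamma_diffusion d0 d1 d0 d1) Gamma2_diffusion// mulrA -expr2.
by rewrite ler_wpDl ?sqr_ge0// ler_wpM2r ?sqr_ge0.
Qed.

(** The test function chosen here makes the square in [Gamma2] vanish at [x],
    which requires dividing by [a x]. *)
Lemma curvature_ge_of_CD nu rho x : CD diffusion (Gamma diffusion) nu rho ->
  a x != 0 -> rho * a x <= curvature x.
Proof.
move=> cd ax0.
have [f [[sf cf] f1 f2]] := Cc_infty_jet x 1 (- (2^-1 * a1 x) / a x).
have d0 := smooth_has_derivative 0 sf; have d1 := smooth_has_derivative 1 sf.
have := cd f (conj sf cf) x.
rewrite (Gamma_diffusion d0 d1 d0 d1) Gamma2_diffusion// f1 f2.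
by rewrite [a x * (_ / _)]mulrC divfK// !mulr1 addNr expr0n add0r expr1n mulr1.
Qed.

End Diffusion.

(** * The operator L *)

Section LogWeightedDiffusion.
Variables (R : realType) (beta sigma : R).
Hypothesis sigma1 : 1 <= sigma.
Implicit Types x t : R.

Let w := omega sigma.
Let l x := ln (w x).

Lemma omega_ge x : sigma <= omega sigma x.
Proof. by rewrite lerDl sqr_ge0. Qed.

Let w_gt0 x : 0 < w x.
Proof. by rewrite (lt_le_trans _ (omega_ge x))// (lt_le_trans ltr01). Qed.

Let a x := w x * l x.
Let b x := 2 * (1 - (beta - 1) * l x) * x.
Let a1 x := 2 * x * (l x + 1).
Let a2 x := 2 * (l x + 1) + 4 * x ^+ 2 / w x.
Let b1 x := 2 * (1 - (beta - 1) * l x) - 4 * (beta - 1) * (x ^+ 2 / w x).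
Let b2 x := - 12 * (beta - 1) * (x / w x)
  + 8 * (beta - 1) * (x ^+ 3 * (w x)^-1 ^+ 2).

Let dw : has_derivative w (fun x => 2 * x).
Proof.
apply: has_derivative_ext (has_derivativeD (has_derivative_cst sigma)
  (has_derivativeM (@has_derivative_id R) (@has_derivative_id R))) => x.
- by rewrite /w /omega expr2.
- by ring.
Qed.

Let dl : has_derivative l (fun x => 2 * x / w x).
Proof. exact: has_derivative_ln w_gt0 dw. Qed.

Let da : has_derivative a a1.
Proof.
apply: has_derivative_ext (has_derivativeM dw dl) => // x.
by rewrite /a1; have := w_gt0 x => /lt0r_neq0 ?; field.
Qed.

Let da1 : has_derivative a1 a2.
Proof.
apply: has_derivative_ext (has_derivativeM
  (has_derivativeM (has_derivative_cst 2) (@has_derivative_id R))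
  (has_derivativeD dl (has_derivative_cst 1))) => // x.
rewrite /a2; ring.
Qed.

Let db : has_derivative b b1.
Proof.
apply: has_derivative_ext (has_derivativeM (has_derivativeM
    (has_derivative_cst 2) (has_derivativeD (has_derivative_cst 1)
    (has_derivativeM (has_derivative_cst (- (beta - 1))) dl)))
  (@has_derivative_id R)) => x.
- by rewrite /b; ring.
- by rewrite /b1; ring.
Qed.

Let db1 : has_derivative b1 b2.
Proof.
have dV := has_derivativeV (fun x => lt0r_neq0 (w_gt0 x)) dw.
apply: has_derivative_ext (has_derivativeD (has_derivativeM
    (has_derivative_cst 2) (has_derivativeD (has_derivative_cst 1)
    (has_derivativeM (has_derivative_cst (- (beta - 1))) dl)))
  (has_derivativeM (has_derivative_cst (- (4 * (beta - 1))))
    (has_derivativeM (has_derivativeM (@has_derivative_id R)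
      (@has_derivative_id R)) dV))) => x.
- by rewrite /b1; ring.
- by rewrite /b2; ring.
Qed.

Lemma L_diffusion : L beta sigma = diffusion a b.
Proof. by []. Qed.

(** Replacing [sigma] by [w - x^2] turns this into an identity of rational
    functions in which [l] is an independent variable. *)
Lemma curvature_L x : curvature a a1 a2 b b1 x - (2 * beta - 1) * a x =
  w x - sigma * (1 + 2 * beta * l x - (2 * beta - 1) * l x ^+ 2).
Proof.
have w0 := lt0r_neq0 (w_gt0 x).
have -> : sigma = w x - x ^+ 2 by rewrite /w /omega addrK.
by rewrite /curvature /a2 /b1 /b /a1 /a; field.
Qed.

Lemma CD_L nu :
  (forall x, sigma * (1 + 2 * beta * ln (omega sigma x)
     - (2 * beta - 1) * ln (omega sigma x) ^+ 2) <= omega sigma x) ->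
  CD (L beta sigma) (Gamma (L beta sigma)) nu (2 * beta - 1).
Proof.
move=> H; rewrite L_diffusion; apply: (CD_diffusion da da1 db db1) => x.
by rewrite -subr_ge0 curvature_L subr_ge0; exact: H.
Qed.

(** The condition [1 < w] excludes only the point where the second-order
    coefficient [w ln w] vanishes, namely [x = 0] when [sigma = 1]. *)
Lemma CD_L_necessary nu x :
  CD (L beta sigma) (Gamma (L beta sigma)) nu (2 * beta - 1) ->
  1 < omega sigma x ->
  sigma * (1 + 2 * beta * ln (omega sigma x)
     - (2 * beta - 1) * ln (omega sigma x) ^+ 2) <= omega sigma x.
Proof.
rewrite L_diffusion => /(curvature_ge_of_CD da da1 db db1) H w1.
rewrite -subr_ge0 -curvature_L subr_ge0; apply: H.
by rewrite mulf_neq0 ?lt0r_neq0//; exact: ln_gt0.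
Qed.

End LogWeightedDiffusion.

(** * The critical value of sigma *)

Theorem theorem3p2 (R : realType) (beta sigma : R)
    (hbeta : 1 / 2 < beta) (hsigma : 1 <= sigma) :
  CD (L beta sigma) (Gamma (L beta sigma)) (mu beta sigma) (2 * beta - 1) <->
  sigma_crit beta <= sigma.
Proof.
have rho0 : 0 < 2 * beta - 1 by lra.
have sigma0 : 0 < sigma by exact: lt_le_trans ltr01 hsigma.
rewrite /sigma_crit -[X in _ <= X](lnK sigma0) ler_expR ler_pdivrMr//.
split=> [cd|crit].
- have [sigma_gt1|] := ltP 1 sigma.
    have := CD_L_necessary (x := 0) hsigma cd.
    rewrite /omega expr0n addr0 => /(_ sigma_gt1).
    have := ln_gt0 sigma_gt1; set s := ln sigma => s0.
    rewrite -ler_pdivlMl// mulVf ?gt_eqF// => H.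
    by rewrite -(ler_pM2r s0); nra.
  move=> sigma_le1; have sigma1 : sigma = 1 by apply/le_anti/andP.
  exfalso.
  (* Test at the point where [ln w = t].  The criterion and the bound
     [exp t <= 1 / (1 - t)] give [(1 - t) (1 + 2 beta t - rho t^2) <= 1] with
     [rho = 2 beta - 1].  As [rho = 4 beta t], the left side equals
     [1 + t^2 + rho t^3]. *)
  set t := (2 * beta - 1) / (4 * beta).
  have tE : 4 * beta * t = 2 * beta - 1 by rewrite /t; field; lra.
  have t0 : 0 < t by rewrite divr_gt0//; lra.
  have et : 1 < expR t by rewrite expR_gt1.
  have wE : omega sigma (Num.sqrt (expR t - 1)) = expR t.
    by rewrite /omega sigma1 sqr_sqrtr ?subr_ge0 ?ltW// addrC subrK.
  have := CD_L_necessary (x := Num.sqrt (expR t - 1)) hsigma cd.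
  rewrite wE => /(_ et); rewrite expRK sigma1 mul1r => H.
  have := expR_ge1Dx (- t); rewrite expRN => Ht.
  have t1 : t < 1 by nra.
  have H2 : (1 - t) * expR t <= 1.
    by rewrite -ler_pdivlMr ?expR_gt0// div1r.
  have H3 : (1 - t) * (1 + 2 * beta * t - (2 * beta - 1) * t ^+ 2) <= 1.
    by apply: le_trans H2; rewrite ler_wpM2l// subr_ge0 ltW.
  have : (1 - t) * (1 + 2 * beta * t - (2 * beta - 1) * t ^+ 2) =
      1 + t * (t + (2 * beta - 1) * t ^+ 2) + t * (2 * beta - 1 - 4 * beta * t).
    by ring.
  rewrite tE subrr mulr0 addr0 => H4; move: H3; rewrite H4 gerDl leNgt.
  by rewrite mulr_gt0// addr_gt0// mulr_gt0// exprn_gt0.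
- apply: CD_L => // x; apply: le_trans (omega_ge sigma x).
  rewrite ler_piMr ?(ltW sigma0)//.
  have ls : ln sigma <= ln (omega sigma x).
    by rewrite ler_ln ?posrE ?omega_ge// (lt_le_trans sigma0 (omega_ge _ _)).
  have l0 := le_trans (ln_ge0 hsigma) ls.
  have lcrit : 2 * beta <= ln (omega sigma x) * (2 * beta - 1).
    by apply: le_trans crit _; rewrite ler_wpM2r// ltW.
  rewrite -subr_ge0 (_ : _ - _ = ln (omega sigma x) *
    (ln (omega sigma x) * (2 * beta - 1) - 2 * beta)); last by ring.
  by rewrite mulr_ge0// subr_ge0.
Qed.
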